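(* For any fixed integer $k\geq1$, the two sequences $\{\mathrm{JS}(k+n,n;z)\}_{n\geq0}$ and $\{\mathrm{js}(k+n,n;z)\}_{n\geq 0}$ are P\'olya frequency sequences if and only if $-1\leq z\leq1$.
   Context: The Jacobi-Stirling numbers of the first kind $\mathrm{js}(n,k;z)$ and of the second kind $\mathrm{JS}(n,k;z)$ ($n\geq k\geq 0$) are defined by $\mathrm{js}(n,k;z)=\mathrm{js}(n-1,k-1;z)+(n-1)(n-1+z)\mathrm{js}(n-1,k;z)$ and $\mathrm{JS}(n,k;z)=\mathrm{JS}(n-1,k-1;z)+k(k+z)\mathrm{JS}(n-1,k;z)$, with $\mathrm{JS}(0,0;z)=\mathrm{js}(0,0;z)=1$ and $\mathrm{JS}(j,0;z)=\mathrm{JS}(0,j;z)=\mathrm{js}(j,0;z)=\mathrm{js}(0,j;z)=0$ for $j\geq1$. Here $z$ is a real number. A real sequence $\{a_n\}_{n\geq0}$ is a P\'olya frequency (PF) sequence if every minor of the matrix $(a_{j-i})_{i,j\geq0}$ (with $a_k=0$ for $k<0$) is nonnegative. *)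

(* Defs.v *)
From HB Require Import structures.
From mathcomp Require Export all_boot all_order all_algebra.
From mathcomp Require Export reals.
Set Implicit Arguments.
Unset Strict Implicit.
Unset Printing Implicit Defensive.
Import Order.TTheory GRing.Theory Num.Theory.
Local Open Scope ring_scope.

(* The argument order is js z n k and JS z n k for js(n,k;z) and JS(n,k;z).
   Outside the triangle k <= n both vanish: see jacobi_stirling1_small and
   jacobi_stirling2_small. *)
Fixpoint jacobi_stirling1 (R : realType) (z : R) (n k : nat) {struct n} : R :=
  match n, k with
  | 0%N, 0%N => 1
  | 0%N, _.+1 => 0
  | _.+1, 0%N => 0
  | n'.+1, k'.+1 =>
      jacobi_stirling1 z n' k'
      + n'%:R * (n'%:R + z) * jacobi_stirling1 z n' k'.+1
  end.

Fixpoint jacobi_stirling2 (R : realType) (z : R) (n k : nat) {struct n} : R :=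
  match n, k with
  | 0%N, 0%N => 1
  | 0%N, _.+1 => 0
  | _.+1, 0%N => 0
  | n'.+1, k'.+1 =>
      jacobi_stirling2 z n' k'
      + k'.+1%:R * (k'.+1%:R + z) * jacobi_stirling2 z n' k'.+1
  end.

Notation js := jacobi_stirling1.
Notation JS := jacobi_stirling2.

Lemma jacobi_stirling1_small (R : realType) (z : R) (n k : nat) :
  (n < k)%N -> js z n k = 0.
Proof.
elim: n k => [|n IHn] [|k] //= ltnk.
by rewrite !IHn ?mulr0 ?addr0 // ltnW.
Qed.

Lemma jacobi_stirling2_small (R : realType) (z : R) (n k : nat) :
  (n < k)%N -> JS z n k = 0.
Proof.
elim: n k => [|n IHn] [|k] //= ltnk.
by rewrite !IHn ?mulr0 ?addr0 // ltnW.
Qed.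

Definition toeplitz_entry (R : realType) (a : nat -> R) (i j : nat) : R :=
  if (i <= j)%N then a (j - i)%N else 0.

(* A minor of order m is given by strictly increasing row indices r and column
   indices c. *)
Definition PF_sequence (R : realType) (a : nat -> R) : Prop :=
  forall (m : nat) (r c : 'I_m -> nat),
    (forall i j : 'I_m, (i < j)%N -> (r i < r j)%N) ->
    (forall i j : 'I_m, (i < j)%N -> (c i < c j)%N) ->
    0 <= \det (\matrix_(i < m, j < m) toeplitz_entry a (r i) (c j)).

(* Main.v *)
(* The generating function of n |-> JS(k+n,n;z) is A_k(t)/(1-t)^(3k+1), where
   A_k is obtained from A_(k-1) by two operators of the form t d/dt + c acting
   on A(t)/(1-t)^m; the same holds for js, with other constants c.

   If -1 < z < 1, each such operator preserves the property of being t times a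
   polynomial with simple negative roots (Rolle-type interlacing), and the
   Toeplitz minors of products of factors C, t + r and 1/(1-t) are nonnegative;
   z = 1 and z = -1 follow since every minor is a polynomial in z.

   Conversely, letting a column of a Toeplitz minor go to infinity removes a
   factor 1/(1-t), so that both numerators have nonnegative coefficients.
   Reversing the numerator of JS at z gives that of js at -z, hence one may
   assume z < -1. If k is odd, JS(k+1,1;z) = (1+z)^k < 0. If -2 < z < -1, then
   js(k+1,1;z) < 0. Otherwise let p be the integer part of -z and
   X_i = -i(i+z), nonnegative for i <= p and minimal at i = p. Nonnegativity of
   the numerator forces the increment X_p h_(k-1)(X_1..X_p) of the sequence at p
   to be at least 3k/(3k+p-1) times h_k(X_1..X_p), while minimality of X_p
   bounds it by k/(k+p-1) times the same quantity. *)

Require Import Defs.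
From mathcomp Require Import all_boot all_order all_algebra.
From mathcomp Require Import reals polyrcf ring lra zify.
Import Order.TTheory GRing.Theory Num.Theory.
Local Open Scope ring_scope.
Set Implicit Arguments.
Unset Strict Implicit.
Unset Printing Implicit Defensive.

(** * Coefficients of p(t)/(1-t)^m *)

Section PartialSums.
Variable R : realType.
Implicit Types (a b : nat -> R) (p : {poly R}).

Definition psum a n : R := \sum_(j < n.+1) a j.

Lemma psum0 a : psum a 0 = a 0%N.
Proof. exact: big_ord1. Qed.

Lemma psumS a n : psum a n.+1 = psum a n + a n.+1.
Proof. by rewrite /psum big_ord_recr. Qed.

(* The coefficient of t^n in p(t) / (1 - t)^m. *)
Definition gcoef p m : nat -> R := iter m psum (fun n => p`_n).

Lemma gcoef0 p m : gcoef p m 0 = p`_0.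
Proof. by elim: m => // m IHm; rewrite -IHm; apply: psum0. Qed.

Lemma gcoefS p m n : gcoef p m.+1 n.+1 = gcoef p m.+1 n + gcoef p m n.+1.
Proof. exact: psumS. Qed.

Lemma gcoefD p q m n : gcoef (p + q) m n = gcoef p m n + gcoef q m n.
Proof.
elim: m n => [|m IHm] n; first by rewrite /gcoef /= coefD.
elim: n => [|n IHn]; first by rewrite !gcoef0 coefD.
by rewrite !gcoefS IHn IHm addrACA.
Qed.

Lemma gcoefXM p m n : gcoef ('X * p) m n.+1 = gcoef p m n.
Proof.
elim: m n => [|m IHm] n; first by rewrite /gcoef /= coefXM.
elim: n => [|n IHn].
  by rewrite gcoefS IHm !gcoef0 coefXM add0r.
by rewrite gcoefS IHn IHm -gcoefS.
Qed.

(* Multiplying the n-th coefficient of p(t) / (1 - t)^m by n + c gives the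
   coefficients of (theta_op c m p)(t) / (1 - t)^(m + 1). *)
Definition theta_op (c : R) (m : nat) p : {poly R} :=
  (1 - 'X) * (c *: p + 'X * p^`()) + m%:R *: ('X * p).

Lemma coef_theta_op0 c m p : (theta_op c m p)`_0 = c * p`_0.
Proof.
rewrite /theta_op mulrBl mul1r !(coefD, coefN, coefXM, coefZ) /=; ring.
Qed.

Lemma coef_theta_opS c m p j :
  (theta_op c m p)`_j.+1 =
    (j.+1%:R + c) * p`_j.+1 + (m%:R - c - j%:R) * p`_j.
Proof.
rewrite /theta_op mulrBl mul1r coefD coefB coefD !coefZ !coefXM /=.
rewrite coefD coefZ !coefXM !coef_deriv.
case: j => [|j] /=; first by rewrite mulr1n; ring.
ring.
Qed.

(** Multiplication by t shifts the index by one, so the multiplier n + c becomes n + 1 + c. *)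
Lemma theta_opXM c m p : theta_op c m ('X * p) = 'X * theta_op (c + 1) m p.
Proof.
apply/polyP => -[|j]; first by rewrite coef_theta_op0 !coefXM /= mulr0.
rewrite coef_theta_opS !coefXM /=; case: j => [|j] /=.
  by rewrite coef_theta_op0; ring.
rewrite coef_theta_opS -[j.+2%:R]natr1; ring.
Qed.

Lemma theta_opS c m p : theta_op c m.+1 p = theta_op c m p + 'X * p.
Proof. by rewrite /theta_op -natr1 scalerDl scale1r addrA. Qed.

Lemma gcoef_theta_op c m p n :
  (n%:R + c) * gcoef p m n = gcoef (theta_op c m p) m.+1 n.
Proof.
elim: m n => [|m IHm]; elim=> [|n IHn].
- by rewrite !gcoef0 coef_theta_op0; ring.
- by rewrite gcoefS -IHn /gcoef /= coef_theta_opS -natr1; ring.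
- by rewrite !gcoef0 coef_theta_op0; ring.
rewrite [in RHS]gcoefS -IHn theta_opS gcoefD -IHm gcoefXM gcoefS -natr1; ring.
Qed.

Lemma theta_op_eval1 c m p : (theta_op c m p).[1] = m%:R * p.[1].
Proof.
rewrite /theta_op hornerD hornerM hornerZ hornerM hornerX mul1r.
by rewrite hornerD hornerN hornerX hornerC subrr mul0r add0r.
Qed.

Lemma size_theta_op c m p d : (size p <= d -> size (theta_op c m p) <= d.+1)%N.
Proof.
move=> sp; apply/leq_sizeP => -[//|j] ltdj.
by rewrite coef_theta_opS !nth_default ?mulr0 ?addr0 // (leq_trans sp) // ltnW.
Qed.

End PartialSums.

(** * Numerators of the two generating functions *)

Section NumeratorPolynomials.
Variables (R : realType) (z : R).

(** The recurrence multiplies by n and n + z, then sums over n: two [theta_op] and one [psum], so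
    the exponent of 1/(1-t) grows by three. *)
Fixpoint JSnum k : {poly R} :=
  if k is k'.+1 then theta_op z (3 * k' + 2) (theta_op 0 (3 * k' + 1) (JSnum k'))
  else 1.

(** Here the recurrence multiplies js(k+n,n) by (n+k)(n+k+z). *)
Fixpoint jsnum k : {poly R} :=
  if k is k'.+1 then
    theta_op (k'%:R + z) (3 * k' + 2) (theta_op k'%:R (3 * k' + 1) (jsnum k'))
  else 1.

Lemma JSnn n : JS z n n = 1.
Proof.
elim: n => //= n ->.
by rewrite jacobi_stirling2_small // mulr0 addr0.
Qed.

Lemma jsnn n : js z n n = 1.
Proof.
elim: n => //= n ->.
by rewrite jacobi_stirling1_small // mulr0 addr0.
Qed.

Lemma gcoef1 n : gcoef (1 : {poly R}) 1 n = 1.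
Proof.
elim: n => [|n IHn]; first by rewrite gcoef0 coef1.
by rewrite gcoefS IHn /gcoef /= coef1 addr0.
Qed.

Lemma JS_gcoef k n : JS z (k + n) n = gcoef (JSnum k) (3 * k + 1) n.
Proof.
elim: k n => [|k IHk] n; first by rewrite add0n JSnn gcoef1.
rewrite [JSnum _]/= (_ : 3 * k.+1 + 1 = (3 * k + 1).+3)%N; last by lia.
elim: n => [|n IHn].
  by rewrite gcoef0 !coef_theta_op0 addSn /=; ring.
rewrite gcoefS -IHn (_ : (3 * k + 2 = (3 * k + 1).+1)%N); last by lia.
by rewrite -!gcoef_theta_op -IHk !addSn addnS /= addr0 mulrCA mulrA.
Qed.

Lemma js_gcoef k n : js z (k + n) n = gcoef (jsnum k) (3 * k + 1) n.
Proof.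
elim: k n => [|k IHk] n; first by rewrite add0n jsnn gcoef1.
rewrite [jsnum _]/= (_ : 3 * k.+1 + 1 = (3 * k + 1).+3)%N; last by lia.
elim: n => [|n IHn].
  (* The new constant term is k(k+z)js(k,0), zero through the factor k if k = 0 and through js(k,0)
     otherwise. *)
  rewrite gcoef0 !coef_theta_op0 addSn /=.
  have := IHk 0%N; rewrite gcoef0; case: (k) => [|k'] /= <-; ring.
rewrite gcoefS -IHn (_ : (3 * k + 2 = (3 * k + 1).+1)%N); last by lia.
rewrite -!gcoef_theta_op -IHk !addSn addnS /= -natr1 natrD -natr1; ring.
Qed.

(** Positivity at 1 controls the growth of the coefficients when factors 1/(1-t) are removed. *)
Lemma JSnum_eval1 k : 0 < (JSnum k).[1].
Proof.
elim: k => [|k IHk]; first by rewrite hornerE.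
by rewrite /= !theta_op_eval1 !mulr_gt0 ?ltr0n //; lia.
Qed.

Lemma jsnum_eval1 k : 0 < (jsnum k).[1].
Proof.
elim: k => [|k IHk]; first by rewrite hornerE.
by rewrite /= !theta_op_eval1 !mulr_gt0 ?ltr0n //; lia.
Qed.

Lemma size_JSnum k : (size (JSnum k) <= (2 * k).+1)%N.
Proof.
elim: k => [|k IHk] /=; first by rewrite size_poly1.
by rewrite (_ : 2 * k.+1 = (2 * k).+2)%N ?size_theta_op //; lia.
Qed.

Lemma size_jsnum k : (size (jsnum k) <= (2 * k).+1)%N.
Proof.
elim: k => [|k IHk] /=; first by rewrite size_poly1.
by rewrite (_ : 2 * k.+1 = (2 * k).+2)%N ?size_theta_op //; lia.
Qed.

End NumeratorPolynomials.

(** * Reversal symmetry between the numerators *)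

Section Reversal.
Variable R : realType.

Definition revp (d : nat) (p q : {poly R}) :=
  forall i j, (i + j = d)%N -> p`_i = q`_j.

(** The two multipliers in [coef_theta_opS] trade places under reversal exactly when c + c' = m -
    d. *)
Lemma revp_theta_op d (c c' : R) m (p q : {poly R}) :
  (size p <= d.+1)%N -> (size q <= d.+1)%N -> c + c' = m%:R - d%:R ->
  revp d p q -> revp d.+1 (theta_op c m p) (theta_op c' m q).
Proof.
move=> sp sq ec rpq.
have {}ec : c = m%:R - d%:R - c' by rewrite -ec addrK.
move=> [|i] [|j] // eij.
- have -> : j = d by lia.
  rewrite coef_theta_op0 coef_theta_opS (rpq 0%N d) //.
  have -> : q`_d.+1 = 0 by rewrite nth_default.
  by rewrite ec; ring.
- have -> : i = d by lia.
  rewrite coef_theta_op0 coef_theta_opS (rpq d 0%N) ?addn0 //.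
  have -> : p`_d.+1 = 0 by rewrite nth_default.
  by rewrite ec; ring.
rewrite !coef_theta_opS (rpq i j.+1) ?(rpq i.+1 j); [|lia..].
rewrite ec (_ : d = i + j.+1)%N; last by lia.
rewrite natrD -!natr1; ring.
Qed.

(** For k >= 1 the exponents run from 1 to 2k, hence the total 2k+1 and the induction from k = 1.
    The constants match: 0 + k = (3k+1) - (2k+1) and z + (k-z) = (3k+2) - (2k+2). *)
Lemma revp_JSnum_jsnum (z : R) k :
  (0 < k)%N -> revp (2 * k).+1 (JSnum z k) (jsnum (- z) k).
Proof.
case: k => // k _; elim: k => [|k IHk].
  rewrite /revp /= => -[|[|[|[|i]]]] [|[|[|[|j]]]] // _;
  rewrite ?(coef_theta_op0, coef_theta_opS) !coef1 /=; ring.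
rewrite (_ : 2 * k.+2 = (2 * k.+1).+2)%N; last by lia.
have s1 : (size (JSnum z k.+1) <= (2 * k.+1).+2)%N by apply/leqW/size_JSnum.
have s2 : (size (jsnum (- z) k.+1) <= (2 * k.+1).+2)%N
  by apply/leqW/size_jsnum.
rewrite [JSnum z k.+2]/= [jsnum (- z) k.+2]/=.
apply: revp_theta_op; [exact: size_theta_op|exact: size_theta_op| |].
  rewrite !(natrD, natrM, =^~natr1); ring.
apply: revp_theta_op => //.
rewrite !(natrD, natrM, =^~natr1); ring.
Qed.

End Reversal.

(** * Replacing the rows of a minor *)

Section RowExpansion.
Variables (R : realType) (m : nat).

(** The cofactors along row [q] do not involve that row, so one [C] serves every [x]. *)
Lemma det_row_linear (q : 'I_m) (rows : 'I_m -> 'rV[R]_m) :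
  exists C : 'cV[R]_m, forall x,
    \det (\matrix_i (if i == q then x else rows i)) = (x *m C) 0 0.
Proof.
exists (\col_j cofactor (\matrix_i rows i) q j) => x.
rewrite (expand_det_row _ q) mxE; apply: eq_bigr => j _.
rewrite !mxE eqxx; congr (_ * (_ * \det _)).
by apply/matrixP => a b; rewrite !mxE eq_sym (negPf (neq_lift _ _)).
Qed.

(* The hypothesis relating u and v says, by duality, that v r lies in the cone
   spanned by u r, ..., u r' up to a multiple of v r'. Replacing the rows v by
   rows u one at a time from the top, the multiple of v r' is absorbed by the
   next row. *)
Lemma det_rows_ge0 (u v : nat -> 'rV[R]_m) (N : nat) (r : 'I_m -> nat) :
  (forall s : 'I_m -> nat, (forall i j : 'I_m, (i < j)%N -> (s i < s j)%N) ->
     0 <= \det (\matrix_i u (s i))) ->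
  (forall r r' (C : 'cV[R]_m), (r < r')%N ->
     (forall s, (r <= s <= r')%N -> 0 <= (u s *m C) 0 0) ->
     (v r' *m C) 0 0 = 0 -> 0 <= (v r *m C) 0 0) ->
  v N = 0 -> (forall i j : 'I_m, (i < j)%N -> (r i < r j)%N) ->
  (forall i, (r i < N)%N) -> 0 <= \det (\matrix_i v (r i)).
Proof.
move=> u_ge0 uv vN0 r_incr r_lt.
(* Weakly increasing indices suffice, since a repeated row makes the determinant vanish. *)
have u_ge0w (s : 'I_m -> nat) :
    (forall i j : 'I_m, (i < j)%N -> (s i <= s j)%N) ->
    0 <= \det (\matrix_i u (s i)).
  move=> s_incr.
  have [/forallP s_lt|] := boolP [forall i : 'I_m, forall j : 'I_m, (i < j)%N ==> (s i < s j)%N].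
    by apply: u_ge0 => i j ltij; move: (s_lt i) => /forallP/(_ j)/implyP; apply.
  rewrite negb_forall => /existsP[i]; rewrite negb_forall => /existsP[j].
  rewrite negb_imply => /andP[ltij]; rewrite -leqNgt => lesji.
  rewrite (determinant_alternate (i1 := i) (i2 := j)) //.
    by rewrite -val_eqE /= ltn_eqF.
  have es : s i = s j by apply/eqP; rewrite eqn_leq s_incr.
  by move=> k; rewrite !mxE es.
have r_incrw (i j : 'I_m) : (i <= j)%N -> (r i <= r j)%N.
  by rewrite leq_eqVlt => /orP[/eqP/val_inj->//|/r_incr/ltnW].
(* Hybrid minors: the first [q] rows come from [u], the others from [v]. The induction goes down
   from q = m to q = 0. *)
suff step k q (s : nat -> nat) : (q + k = m)%N ->
    (forall i j, (i <= j)%N -> (j < q)%N -> (s i <= s j)%N) ->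
    (forall i (j : 'I_m), (i < q)%N -> (q <= j)%N -> (s i <= r j)%N) ->
    0 <= \det (\matrix_(i < m) if (i < q)%N then u (s i) else v (r i)).
  have := step m 0%N id (add0n _); apply=> //.
elim: k q s => [|k IHk] q s qk s_incr s_le.
  rewrite (_ : matrix_of_fun _ _ = \matrix_i u (s i)).
    apply: u_ge0w => i j ltij; apply: s_incr; first exact: ltnW.
    by have := ltn_ord j; lia.
  by apply/matrixP=> i j; rewrite !mxE (_ : (i < q)%N) //; have := ltn_ord i; lia.
have ltqm : (q < m)%N by lia.
pose q0 := Ordinal ltqm.
have [C HC] := det_row_linear q0 (fun i => if (i < q)%N then u (s i) else v (r i)).
have -> : (\matrix_(i < m) if (i < q)%N then u (s i) else v (r i)) =
    \matrix_i (if i == q0 then v (r q0) else if (i < q)%N then u (s i) else v (r i)).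
  apply/matrixP=> i j; rewrite !mxE; case: eqP => // ->.
  by rewrite ltnn.
rewrite HC.
have ucase r' s0 : (r q0 <= s0 <= r')%N ->
    (forall j : 'I_m, (q < j)%N -> (r' <= r j)%N) -> 0 <= (u s0 *m C) 0 0.
  move=> /andP[le1 le2] ler'; rewrite -HC.
  rewrite (_ : matrix_of_fun _ _ = \matrix_(i < m) if (i < q.+1)%N then
      u (if (i < q)%N then s i else s0) else v (r i)).
    apply: (IHk q.+1 (fun i => if (i < q)%N then s i else s0)); first by lia.
      move=> i j leij ltjq; case: ifP => [ltiq|/negbT geiq].
        by case: ifP => ?; [apply: s_incr | apply: leq_trans le1; apply: s_le].
      by rewrite (_ : (j < q)%N = false) //; lia.
    move=> i j ltiq ltqj; case: ifP => ?; first by apply: s_le; lia.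
    by apply: leq_trans le2 _; apply: ler'.
  apply/matrixP=> i j; rewrite !mxE -val_eqE /=.
  by rewrite ltnS; case: ltngtP => // ->.
(* For the last row take r' = N, where [v] vanishes; otherwise r' is the next row index, and [v r']
   in row [q] would duplicate row q+1. *)
have [ltq1m|geq1m] := ltnP q.+1 m; last first.
  apply: (uv _ N) => //; last by rewrite vN0 mul0mx mxE.
  by move=> s0 hs0; apply: (ucase N) => // j; have := ltn_ord j; lia.
pose q1 := Ordinal ltq1m.
apply: (uv _ (r q1)); first by apply: r_incr.
  by move=> s0 hs0; apply: (ucase (r q1)) => // j ltqj; apply: r_incrw.
rewrite -HC (determinant_alternate (i1 := q0) (i2 := q1)) //.
  by rewrite -val_eqE /= ltn_eqF.
move=> j; rewrite !mxE eqxx -[q1 == q0]val_eqE /= (_ : (q.+1 == q) = false); last by lia.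
by rewrite ltnNge leqnSn.
Qed.

End RowExpansion.

(** * Operations preserving total nonnegativity *)

Section PFClosure.
Variable R : realType.
Implicit Types (a b : nat -> R) (p : {poly R}).

Lemma eq_PF a b : a =1 b -> PF_sequence a -> PF_sequence b.
Proof.
move=> eab PFa m r c hr hc; have := PFa m r c hr hc; congr (0 <= \det _).
by apply/matrixP => i j; rewrite !mxE /toeplitz_entry eab.
Qed.

Lemma toeplitz_entry_gt a i j : (j < i)%N -> toeplitz_entry a i j = 0.
Proof. by move=> ltji; rewrite /toeplitz_entry leqNgt ltji. Qed.

Lemma toeplitz_entry_add a i j : toeplitz_entry a i (i + j) = a j.
Proof. by rewrite /toeplitz_entry leq_addr addKn. Qed.

Lemma PF_transfer a b :
  (forall m (c : 'I_m -> nat) r r' (C : 'cV[R]_m), (r < r')%N ->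
     let u s := \row_j toeplitz_entry a s (c j) in
     let v s := \row_j toeplitz_entry b s (c j) in
     (forall s, (r <= s <= r')%N -> 0 <= (u s *m C) 0 0) ->
     (v r' *m C) 0 0 = 0 -> 0 <= (v r *m C) 0 0) ->
  PF_sequence a -> PF_sequence b.
Proof.
move=> ab PFa m r c hr hc.
pose u s : 'rV[R]_m := \row_j toeplitz_entry a s (c j).
pose v s : 'rV[R]_m := \row_j toeplitz_entry b s (c j).
rewrite (_ : matrix_of_fun _ _ = \matrix_i v (r i)); last first.
  by apply/matrixP=> i j; rewrite !mxE.
(* [N] exceeds all chosen columns, so row [N] is zero on them. *)
pose N := (\sum_j c j + \sum_i r i).+1.
apply: (@det_rows_ge0 _ _ u v N) => //.
- move=> s hs; have := PFa m s c hs hc; congr (0 <= \det _).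
  by apply/matrixP=> i j; rewrite !mxE.
- exact: ab.
- apply/rowP=> j; rewrite !mxE toeplitz_entry_gt // ltnS.
  by rewrite (bigD1 j) //= -addnA leq_addr.
- by move=> i; rewrite ltnS [X in (_ + X)%N](bigD1 i) //= addnCA leq_addr.
Qed.

Lemma toeplitz_entry_psum a i j :
  toeplitz_entry (psum a) i j =
    toeplitz_entry a i j + toeplitz_entry (psum a) i.+1 j.
Proof.
have [ltji|leij] := ltnP j i.
  by rewrite !toeplitz_entry_gt ?addr0 // ltnW.
rewrite -(subnKC leij) !toeplitz_entry_add; case: (j - i)%N => [|d].
  by rewrite psum0 addn0 toeplitz_entry_gt ?addr0.
by rewrite psumS -addSnnS toeplitz_entry_add addrC.
Qed.

(** Row r of [psum a] is the sum of rows r, ..., r'-1 of [a] plus row r' of [psum a]. *)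
Lemma PF_psum a : PF_sequence a -> PF_sequence (psum a).
Proof.
apply: PF_transfer => m c r r' C ltrr' u v.
have vS s : v s = u s + v s.+1.
  by apply/rowP=> j; rewrite !mxE toeplitz_entry_psum.
rewrite -(subnKC (ltnW ltrr')); move: (r' - r)%N => d {ltrr'}.
elim: d r => [|d IHd] {}r ur v0.
  by rewrite addn0 in v0; rewrite v0.
rewrite vS mulmxDl mxE addr_ge0 ?ur ?leqnn ?leq_addr //.
apply: IHd; last by rewrite addSnnS.
by move=> s /andP[? ?]; apply: ur; lia.
Qed.

Lemma PF_scale a (x : R) :
  0 <= x -> PF_sequence a -> PF_sequence (fun n => x * a n).
Proof.
move=> x0; apply: PF_transfer => m c r r' C ltrr' u v ur _.
have -> : v r = x *: u r.
  by apply/rowP=> j; rewrite !mxE /toeplitz_entry; case: ifP; rewrite ?mulr0.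
by rewrite -scalemxAl mxE mulr_ge0 // ur // leqnn ltnW.
Qed.

(** The new row r is x times the old row r plus the old row r+1, and r+1 <= r'. *)
Lemma PF_mulXaddC p (x : R) : 0 <= x ->
  PF_sequence (fun n => p`_n) -> PF_sequence (fun n => (('X + x%:P) * p)`_n).
Proof.
move=> x0; apply: PF_transfer => m c r r' C ltrr' u v ur _.
have -> : v r = x *: u r + u r.+1.
  apply/rowP=> j; rewrite !mxE; have [ltcr|lerc] := ltnP (c j) r.
    by rewrite !toeplitz_entry_gt ?mulr0 ?addr0 // ltnW.
  rewrite -(subnKC lerc) !toeplitz_entry_add mulrDl coefD coefXM coefCM.
  case: (c j - r)%N => [|d] /=.
    by rewrite addn0 toeplitz_entry_gt // addr0 add0r.
  by rewrite -addSnnS toeplitz_entry_add addrC.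
rewrite mulmxDl -scalemxAl !mxE addr_ge0 ?mulr_ge0 //.
  by have := ur r; rewrite mxE; apply; rewrite leqnn ltnW.
by have := ur r.+1; rewrite mxE; apply; rewrite leqnSn.
Qed.

(** These are minors of the identity matrix. At the first i with r i != c i, the smaller of the two
    indices is missed by the other sequence, so row or column i is zero. *)
Lemma PF_one : PF_sequence (fun n => (1 : {poly R})`_n).
Proof.
move=> m r c hr hc.
have entry (i j : 'I_m) : toeplitz_entry (fun n => (1 : {poly R})`_n) (r i) (c j) =
    (r i == c j)%:R.
  rewrite /toeplitz_entry coef1 subn_eq0; case: ltngtP => //.
have [/forallP rc|] := boolP [forall i, r i == c i].
  rewrite (_ : matrix_of_fun _ _ = 1%:M) ?det1 //.
  apply/matrixP=> i j; rewrite !mxE entry (eqP (rc i)).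
  rewrite -val_eqE /=; case: (ltngtP i j) => [/hc|/hc|/val_inj->]; last by rewrite eqxx.
  - by move=> ?; rewrite ltn_eqF.
  - by move=> ?; rewrite gtn_eqF.
rewrite negb_forall => /existsP[i0 ni0].
case: (@arg_minnP _ i0 (fun i => r i != c i) val ni0) => i ni imin.
have rc (j : 'I_m) : (j < i)%N -> r j = c j.
  by move=> ltji; apply/eqP; apply: contraLR ltji => nj; rewrite -leqNgt imin.
have cw (a b : 'I_m) : (a <= b)%N -> (c a <= c b)%N.
  by rewrite leq_eqVlt => /orP[/eqP/val_inj->//|/hc/ltnW].
have rw (a b : 'I_m) : (a <= b)%N -> (r a <= r b)%N.
  by rewrite leq_eqVlt => /orP[/eqP/val_inj->//|/hr/ltnW].
case: (ltngtP (r i) (c i)) ni => // lt_rc _.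
  rewrite (expand_det_row _ i) big1 // => j _; rewrite mxE entry.
  case: eqP => [e|]; last by rewrite mul0r.
  have [/[dup] ltji /rc rcj|/cw] := ltnP j i; last by lia.
  by have := hr _ _ ltji; lia.
rewrite (expand_det_col _ i) big1 // => j _; rewrite mxE entry.
case: eqP => [e|]; last by rewrite mul0r.
have [/[dup] ltji /rc rcj|/rw] := ltnP j i; last by lia.
by have := hc _ _ ltji; lia.
Qed.

Lemma PF_gcoef p m : PF_sequence (fun n => p`_n) -> PF_sequence (gcoef p m).
Proof. by move=> PFp; elim: m => // m; apply: PF_psum. Qed.

Lemma PF_prodXaddC (s : seq R) : all (>= 0) s ->
  PF_sequence (fun n => (\prod_(x <- s) ('X + x%:P) : {poly R})`_n).
Proof.
elim: s => [|x s IHs] /= => [_|/andP[x0 /IHs PFs]].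
  by rewrite big_nil; apply: PF_one.
by rewrite big_cons; apply: PF_mulXaddC.
Qed.

End PFClosure.

(** * Interlacing of roots and sufficiency of the bounds *)

Section RealRootedness.
Variable R : realType.
Implicit Types p q : {poly R}.

Definition simple_neg_roots (e : nat) p : Prop :=
  exists (C : R) (r : nat -> R),
    [/\ 0 < C, forall i, (i < e)%N -> 0 < r i,
        forall i j, (i < j)%N -> (j < e)%N -> r i < r j &
        p = C *: \prod_(i < e) ('X + (r i)%:P)].

(** Exactly the i factors with j < i are negative. Up to a positive constant the product is the
    derivative at the root -r_i. *)
Lemma sign_prod_sub (r : nat -> R) e i : (i < e)%N ->
  (forall i j, (i < j)%N -> (j < e)%N -> r i < r j) ->
  0 < (-1) ^+ i * \prod_(j < e | j != i :> nat) (r j - r i).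
Proof.
elim: e => // e IHe; rewrite ltnS leq_eqVlt => /orP[/eqP->|ltie] r_incr.
  rewrite big_mkcond big_ord_recr /= eqxx mulr1 -big_mkcond /=.
  rewrite (eq_bigl xpredT) => [|j]; last by rewrite ltn_eqF.
  rewrite -[X in _ ^+ X]card_ord -prodr_const -big_split /=.
  by apply: prodr_gt0 => j _; rewrite mulN1r oppr_gt0 subr_lt0 r_incr.
rewrite big_mkcond big_ord_recr /= (gtn_eqF ltie) -big_mkcond /= mulrA.
rewrite mulr_gt0 ?subr_gt0 ?r_incr // IHe // => a b ltab ltbe.
by rewrite r_incr // ltnW.
Qed.

(** The e sign changes give roots in e disjoint intervals; by degree these are all the roots. *)
Lemma interlacing_simple_neg_roots e q (y : nat -> R) :
  size q = e.+1 -> 0 < lead_coef q -> 0 <= y 0%N ->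
  (forall i, (i < e)%N -> y i < y i.+1) ->
  (forall i, (i <= e)%N -> 0 < (-1) ^+ i * q.[- y i]) ->
  simple_neg_roots e q.
Proof.
move=> sq lq y0 y_incr sgn.
have rt i : {x | (i < e)%N -> (y i < x < y i.+1) /\ root q (- x)}.
  have [ltie|] := boolP (i < e)%N; last by exists 0.
  have ltN : - y i.+1 < - y i by rewrite ltrN2 y_incr.
  have opp : q.[- y i.+1] * q.[- y i] < 0.
    have := mulr_gt0 (sgn i (ltnW ltie)) (sgn i.+1 ltie).
    rewrite exprS mulN1r mulrACA mulrN -expr2 sqrr_sign mulN1r mulrC; lra.
  have [x xin rx] := poly_ivtoo (ltW ltN) opp.
  exists (- x) => _; rewrite opprK; split=> //.
  by move: xin; rewrite in_itv /= => /andP[? ?]; apply/andP; split; lra.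
pose r i := sval (rt i).
have rP i : (i < e)%N -> (y i < r i < y i.+1) /\ root q (- r i).
  by move=> ltie; apply: (svalP (rt i)).
have y_incrw i j : (i <= j)%N -> (j <= e)%N -> y i <= y j.
  move=> leij; rewrite -(subnKC leij); elim: (j - i)%N => [|d IHd] le.
    by rewrite addn0.
  rewrite addnS in le *.
  by apply: le_trans (IHd (ltnW le)) _; apply/ltW/y_incr.
have r_gt0 i : (i < e)%N -> 0 < r i.
  move=> ltie; have [/andP[lt1 _] _] := rP i ltie.
  by apply: le_lt_trans lt1; apply: le_trans y0 (y_incrw _ _ _ (ltnW ltie)).
have r_incr i j : (i < j)%N -> (j < e)%N -> r i < r j.
  move=> ltij ltje; have [/andP[_ lt1] _] := rP i (ltn_trans ltij ltje).
  have [/andP[lt2 _] _] := rP j ltje.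
  by apply: lt_trans lt1 (le_lt_trans _ lt2); apply: y_incrw => //; apply: ltnW.
exists (lead_coef q), r; split=> //.
rewrite {1}(@all_roots_prod_XsubC _ q [seq - r i | i <- iota 0 e]).
- congr (_ *: _); rewrite big_map -(big_mkord xpredT (fun i => 'X + (r i)%:P)).
  rewrite /index_iota subn0; apply: eq_bigr => i _.
  by rewrite polyCN opprK.
- by rewrite size_map size_iota.
- by apply/allP => x /mapP[i]; rewrite mem_iota add0n => /andP[_ /rP[_ ?]] ->.
rewrite uniq_rootsE map_inj_in_uniq ?iota_uniq // => i j.
rewrite !mem_iota /= !add0n => lti ltj /oppr_inj.
by case: (ltngtP i j) => // [/r_incr/(_ ltj)|/r_incr/(_ lti)] + eq;
  rewrite eq ltxx.
Qed.

(** At a root -r_i of [p] the image takes the value -r_i(1+r_i)p'(-r_i), whose sign alternates with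
    i. It is positive at 0 because c > 0, and c + e < m makes its leading coefficient positive,
    which fixes the sign far to the left. These e+2 points separate e+1 roots. *)
Lemma theta_op_simple_neg_roots c m e p :
  0 < c -> c + e%:R < m%:R -> simple_neg_roots e p ->
  simple_neg_roots e.+1 (theta_op c m p).
Proof.
move=> c0 cm [C [r [C0 r0 r_incr defp]]].
set q := theta_op c m p.
have monT : \prod_(i < e) ('X + (r i)%:P) \is monic.
  by apply: monic_prod => i _; rewrite monicXaddC.
have sT : size (\prod_(i < e) ('X + (r i)%:P) : {poly R}) = e.+1.
  rewrite (eq_bigr (fun i : 'I_e => 'X - (- r i)%:P)); last first.
    by move=> i _; rewrite polyCN opprK.
  rewrite -(big_mkord xpredT (fun i => 'X - (- r i)%:P)).
  by rewrite size_prod_XsubC size_iota subn0.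
have sp : size p = e.+1 by rewrite defp size_scale ?gt_eqF.
have pe : p`_e = C.
  by have := lead_coefE p; rewrite sp /= => <-; rewrite defp lead_coefZ (monicP monT) mulr1.
have qe : q`_e.+1 = (m%:R - c - e%:R) * C.
  by rewrite coef_theta_opS pe nth_default ?sp // mulr0 add0r.
have qe0 : 0 < q`_e.+1 by rewrite qe mulr_gt0 //; lra.
have sq : size q = e.+2.
  apply/eqP; rewrite eqn_leq size_theta_op ?sp //=.
  by rewrite ltnNge; apply: contraL qe0 => /leq_sizeP/(_ e.+1 (leqnn _)) ->; rewrite ltxx.
have lq : lead_coef q = q`_e.+1 by rewrite lead_coefE sq.
have q_at i : (i < e)%N -> 0 < (-1) ^+ i.+1 * q.[- r i].
  move=> ltie.
  pose T : {poly R} := \prod_(j < e | j != i :> nat) ('X + (r j)%:P).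
  have pT : p = C *: (('X + (r i)%:P) * T).
    by rewrite defp (bigD1 (Ordinal ltie)).
  have p_at : p.[- r i] = 0.
    by rewrite pT hornerZ hornerM hornerD hornerX hornerC addNr mul0r mulr0.
  have p'_at : p^`().[- r i] = C * T.[- r i].
    rewrite pT derivZ hornerZ derivM derivD derivX derivC addr0 mul1r hornerD.
    by rewrite hornerM hornerD hornerX hornerC addNr mul0r addr0.
  have T_at : T.[- r i] = \prod_(j < e | j != i :> nat) (r j - r i).
    rewrite horner_prod; apply: eq_bigr => j _.
    by rewrite hornerD hornerX hornerC addrC.
  have q_r : q.[- r i] = (1 + r i) * (- r i * (C * T.[- r i])).
    rewrite /q /theta_op hornerD hornerM hornerZ hornerM hornerX !hornerD.
    rewrite hornerN hornerX hornerC hornerZ hornerM hornerX p_at p'_at; ring.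
  have := sign_prod_sub ltie r_incr; rewrite -T_at => sT_gt0.
  rewrite q_r (_ : (-1) ^+ i.+1 * _ = (1 + r i) * r i * C * ((-1) ^+ i * T.[- r i])).
    have ri0 := r0 i ltie; apply: mulr_gt0 => //; apply: mulr_gt0 => //.
    by apply: mulr_gt0 => //; lra.
  by rewrite exprS; ring.
have q_0 : 0 < q.[0].
  rewrite horner_coef0 coef_theta_op0 mulr_gt0 // -horner_coef0 defp hornerZ.
  rewrite mulr_gt0 // horner_prod; apply: prodr_gt0 => i _.
  by rewrite hornerD hornerX hornerC add0r r0.
(* The sign makes the leading coefficient of q(-t) positive, so a bound at plus infinity controls
   [q] at minus infinity. *)
pose q' := (-1) ^+ e.+1 *: (q \Po (- 'X)).
have lq' : 0 < lead_coef q'.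
  rewrite /q' lead_coefZ lead_coef_comp ?size_polyN ?size_polyX //.
  by rewrite lead_coefN lead_coefX sq /= mulrCA -expr2 sqrr_sign mulr1 lq.
have [B HB] := poly_pinfty_gt_lc lq'.
pose Y := Num.max B (1 + \sum_(i < e) r i).
have Y_gt i : (i < e)%N -> r i < Y.
  move=> ltie; rewrite lt_max; apply/orP; right.
  rewrite (bigD1 (Ordinal ltie)) //= addrCA ltrDl ltr_pwDl //.
  by apply: sumr_ge0 => j _; apply/ltW/r0.
have Y_gt0 : 0 < Y.
  rewrite lt_max; apply/orP; right; rewrite ltr_pwDl //.
  by apply: sumr_ge0 => j _; apply/ltW/r0.
have q_Y : 0 < (-1) ^+ e.+1 * q.[- Y].
  have := HB Y; rewrite le_max lexx => /(_ isT) /(lt_le_trans lq').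
  by rewrite /q' hornerZ horner_comp hornerN hornerX.
pose y i := if i is i'.+1 then if (i' < e)%N then r i' else Y else 0.
apply: (@interlacing_simple_neg_roots _ _ y) => //; first by rewrite lq.
- move=> [|i] /=; rewrite ltnS => lei; first by case: ifP => // /r0.
  rewrite lei; case: ifP => [lt|_]; [exact: r_incr | exact: Y_gt].
- move=> [|i] /=; first by rewrite oppr0 expr0 mul1r.
  rewrite ltnS leq_eqVlt => /orP[/eqP->|lti]; first by rewrite ltnn.
  by rewrite lti q_at.
Qed.

Lemma simple_neg_roots_PF e p m :
  simple_neg_roots e p -> PF_sequence (gcoef ('X * p) m).
Proof.
move=> [C [r [C0 r0 _ ->]]]; apply: PF_gcoef.
rewrite -scalerAr -[X in X * _]addr0 -polyC0.
have PFs : PF_sequence (fun n =>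
    (('X + 0%:P) * \prod_(i < e) ('X + (r i)%:P) : {poly R})`_n).
  apply: PF_mulXaddC => //.
  rewrite -(big_mkord xpredT (fun i => 'X + (r i)%:P)) /=.
  rewrite -(big_map r xpredT (fun x => 'X + x%:P)).
  apply: PF_prodXaddC; apply/allP => x /mapP[i].
  by rewrite mem_index_iota => /andP[_ /r0 ri0] ->; apply: ltW.
by apply: eq_PF (PF_scale (ltW C0) PFs) => n; rewrite coefZ.
Qed.

Lemma theta_op_0_1 : theta_op 0 1 (1 : {poly R}) = 'X * 1.
Proof. by rewrite /theta_op derivC scale0r mulr0 addr0 mulr0 add0r scale1r. Qed.

Lemma simple_neg_roots1 : simple_neg_roots 0 (1 : {poly R}).
Proof. by exists 1, (fun=> 0); split=> //; rewrite big_ord0 scale1r. Qed.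

(** The constant 0 is not positive, so the induction runs on half steps, starting from
    [theta_op_0_1]. Pulling out t raises the constants 0 and z to 1 and z+1; then z > -1 gives
    positivity, and z + 1 + 2k < 3k + 2 needs z < 1 at k = 0. *)
Lemma JSnum_simple_neg_roots (z : R) k : -1 < z < 1 ->
  exists2 p, JSnum z k.+1 = 'X * p & simple_neg_roots (2 * k).+1 p.
Proof.
move=> /andP[z1 z2].
suff [p pE rp] : exists2 p, theta_op 0 (3 * k + 1) (JSnum z k) = 'X * p &
    simple_neg_roots (2 * k) p.
  exists (theta_op (z + 1) (3 * k + 2) p); first by rewrite /= pE theta_opXM.
  apply: theta_op_simple_neg_roots => //; first by lra.
  have := ler0n R k; rewrite !(natrM, natrD); lra.
elim: k => [|k [p pE rp]]; first by exists 1; [exact: theta_op_0_1 | exact: simple_neg_roots1].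
exists (theta_op (0 + 1) (3 * k.+1 + 1) (theta_op (z + 1) (3 * k + 2) p)).
  by rewrite [JSnum _ _]/= pE !theta_opXM.
rewrite (_ : 2 * k.+1 = (2 * k).+2)%N; last by lia.
have k0 := ler0n R k.
apply: theta_op_simple_neg_roots; first by lra.
  by rewrite !(natrM, natrD, =^~natr1); lra.
apply: theta_op_simple_neg_roots => //; first by lra.
by rewrite !(natrM, natrD); lra.
Qed.

(** Same half steps; the condition k + z + 1 + 2k < 3k + 2 now amounts to z < 1 for every k. *)
Lemma jsnum_simple_neg_roots (z : R) k : -1 < z < 1 ->
  exists2 p, jsnum z k.+1 = 'X * p & simple_neg_roots (2 * k).+1 p.
Proof.
move=> /andP[z1 z2].
suff [p pE rp] : exists2 p, theta_op k%:R (3 * k + 1) (jsnum z k) = 'X * p &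
    simple_neg_roots (2 * k) p.
  exists (theta_op (k%:R + z + 1) (3 * k + 2) p); first by rewrite /= pE theta_opXM.
  have := ler0n R k => k0.
  apply: theta_op_simple_neg_roots => //; first by lra.
  rewrite !(natrM, natrD); lra.
elim: k => [|k [p pE rp]]; first by exists 1; [exact: theta_op_0_1 | exact: simple_neg_roots1].
exists (theta_op (k.+1%:R + 1) (3 * k.+1 + 1)
  (theta_op (k%:R + z + 1) (3 * k + 2) p)).
  by rewrite [jsnum _ _]/= pE !theta_opXM.
rewrite (_ : 2 * k.+1 = (2 * k).+2)%N; last by lia.
have k0 := ler0n R k.
apply: theta_op_simple_neg_roots; first by rewrite -natr1; lra.
  by rewrite !(natrM, natrD, =^~natr1); lra.
apply: theta_op_simple_neg_roots => //; first by lra.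
by rewrite !(natrM, natrD); lra.
Qed.

(** A minor is a polynomial in z, so a negative value would persist at nearby points of the open
    interval. *)
Lemma PF_closed_pm1 (f : nat -> {poly R}) :
  (forall z, -1 < z < 1 -> PF_sequence (fun n => (f n).[z])) ->
  forall z, -1 <= z <= 1 -> PF_sequence (fun n => (f n).[z]).
Proof.
move=> PFf z zin m r c hr hc.
pose M : 'M[{poly R}]_m :=
  \matrix_(i, j) (if (r i <= c j)%N then f (c j - r i)%N else 0).
have detE x : \det (\matrix_(i < m, j < m)
    toeplitz_entry (fun n => (f n).[x]) (r i) (c j)) = (\det M).[x].
  rewrite -[RHS]/(horner_eval x (\det M)) -det_map_mx; congr (\det _).
  apply/matrixP=> i j; rewrite !mxE /toeplitz_entry /horner_eval.
  by case: ifP => // _; apply/esym/horner0.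
rewrite detE leNgt; apply/negP => neg.
have [|d d0 Hd] := @poly_cont _ z (\det M) (- (\det M).[z]).
  by rewrite oppr_gt0.
(* The point z(1-e) lies strictly between -1 and 1, at distance at most e <= d/2 from z. *)
pose e := Num.min (2^-1) (d / 2).
have e0 : 0 < e by rewrite lt_min !divr_gt0 ?invr_gt0 ?ltr0n.
have e1 : e <= 2^-1 by rewrite ge_min lexx.
have e2 : e <= d / 2 by rewrite ge_min lexx orbT.
have in1 : -1 < z * (1 - e) < 1 by move: zin => /andP[? ?]; apply/andP; split; nra.
have near : `|z * (1 - e) - z| < d.
  rewrite ltr_norml; move: zin => /andP[? ?]; apply/andP; split; nra.
have := PFf _ in1 m r c hr hc; rewrite detE.
have := Hd _ near; rewrite ltr_norml => /andP[_]; lra.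
Qed.

Fixpoint JSpoly n k : {poly R} :=
  match n, k with
  | 0%N, 0%N => 1
  | n'.+1, k'.+1 =>
      JSpoly n' k' + k'.+1%:R *: ((k'.+1%:R)%:P + 'X) * JSpoly n' k'.+1
  | _, _ => 0
  end.

Fixpoint jspoly n k : {poly R} :=
  match n, k with
  | 0%N, 0%N => 1
  | n'.+1, k'.+1 =>
      jspoly n' k' + n'%:R *: ((n'%:R)%:P + 'X) * jspoly n' k'.+1
  | _, _ => 0
  end.

Lemma JSpolyE z n k : (JSpoly n k).[z] = JS z n k.
Proof.
elim: n k => [|n IHn] [|k] /=; rewrite ?horner0 ?hornerC //.
by rewrite hornerD hornerM hornerZ hornerD hornerX hornerC !IHn.
Qed.

Lemma jspolyE z n k : (jspoly n k).[z] = js z n k.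
Proof.
elim: n k => [|n IHn] [|k] /=; rewrite ?horner0 ?hornerC //.
by rewrite hornerD hornerM hornerZ hornerD hornerX hornerC !IHn.
Qed.

Lemma JS_PF k (z : R) : (0 < k)%N -> -1 <= z <= 1 ->
  PF_sequence (fun n => JS z (k + n) n).
Proof.
case: k => // k _ zin.
apply: (@eq_PF _ (fun n => (JSpoly (k.+1 + n) n).[z])) => [n|].
  exact: JSpolyE.
apply: PF_closed_pm1 => // x xin.
have [p pE rp] := JSnum_simple_neg_roots k xin.
apply: eq_PF (simple_neg_roots_PF (3 * k.+1 + 1) rp) => n.
by rewrite JSpolyE JS_gcoef pE.
Qed.

Lemma js_PF k (z : R) : (0 < k)%N -> -1 <= z <= 1 ->
  PF_sequence (fun n => js z (k + n) n).
Proof.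
case: k => // k _ zin.
apply: (@eq_PF _ (fun n => (jspoly (k.+1 + n) n).[z])) => [n|].
  exact: jspolyE.
apply: PF_closed_pm1 => // x xin.
have [p pE rp] := jsnum_simple_neg_roots k xin.
apply: eq_PF (simple_neg_roots_PF (3 * k.+1 + 1) rp) => n.
by rewrite jspolyE js_gcoef pE.
Qed.

End RealRootedness.

(** * Necessity of the bounds *)

Section Necessity.
Variable R : realType.
Implicit Types (a b : nat -> R) (p : {poly R}).

(** The rows are consecutive so that differences of successive rows of [psum a] are rows of [a]. *)
Definition top_minors_ge0 a : Prop :=
  forall m (c : 'I_m -> nat), (forall i j : 'I_m, (i < j)%N -> (c i < c j)%N) ->
    0 <= \det (\matrix_(i < m, j < m) toeplitz_entry a i (c j)).

Lemma PF_top_minors a : PF_sequence a -> top_minors_ge0 a.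
Proof. by move=> PFa m c; apply: (PFa m (fun i => val i) c). Qed.

Lemma top_minors_coef a n : top_minors_ge0 a -> 0 <= a n.
Proof.
move=> Ha; have := Ha 1%N (fun=> n); rewrite det_mx11 mxE.
rewrite /toeplitz_entry leq0n subn0; apply=> i j.
by rewrite !ord1.
Qed.

(** The shift l is needed because a far column meets different rows at different indices. *)
Definition negligible a b : Prop :=
  forall (K : R) (l : nat), 0 <= K ->
    exists N, forall n, (N <= n)%N -> K * `|a (n + l)%N| <= b n.

Definition eventually_positive a : Prop :=
  exists2 c : R, 0 < c & exists N, forall n, (N <= n)%N -> c <= a n.

Lemma eventually_all (m : nat) (P : 'I_m -> nat -> Prop) :
  (forall i, exists N, forall n, (N <= n)%N -> P i n) ->
  exists N, forall n, (N <= n)%N -> forall i, P i n.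
Proof.
elim: m P => [|m IHm] P HP; first by exists 0%N => n _ [].
have [N1 H1] := HP ord_max.
have [N2 H2] := IHm (fun i => P (widen_ord (leqnSn m) i)) (fun i => HP _).
exists (maxn N1 N2) => n; rewrite geq_max => /andP[n1 n2] i.
have [lti|gei] := ltnP i m.
  have -> : i = widen_ord (leqnSn m) (Ordinal lti) by apply: val_inj.
  exact: H2.
have -> : i = ord_max by apply: val_inj => /=; have := ltn_ord i; lia.
exact: H1.
Qed.

Lemma toeplitz_entry_psum_split a m i j : (i <= m)%N ->
  toeplitz_entry (psum a) i j =
    \sum_(s < m) (i <= s)%:R * toeplitz_entry a s j + toeplitz_entry (psum a) m j.
Proof.
move=> leim; elim: m leim => [|m IHm].
  by rewrite leqn0 => /eqP->; rewrite big_ord0 add0r.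
rewrite leq_eqVlt => /orP[/eqP->|].
  by rewrite big1 ?add0r // => s _; rewrite leqNgt ltn_ord mul0r.
rewrite ltnS => leim; rewrite IHm // big_ord_recr /= leim mul1r.
by rewrite -addrA -toeplitz_entry_psum.
Qed.

(** Block factorization through the Schur complement of [D]. *)
Lemma det_bordered m (D : 'M[R]_m) (x : 'cV[R]_m) (g : 'rV[R]_m) (y : R) :
  \det D != 0 ->
  \det (block_mx D x g y%:M) = \det D * (y - (g *m invmx D *m x) 0 0).
Proof.
move=> D0; have uD : D \in unitmx by rewrite unitmxE unitfE.
have -> : block_mx D x g y%:M = block_mx D 0 g 1%:M *m
    block_mx 1%:M (invmx D *m x) 0 (y%:M - g *m invmx D *m x).
  rewrite mulmx_block !mulmx1 !mulmx0 !mul0mx !addr0 mulKVmx // mul1mx mulmxA.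
  by rewrite addrC subrK.
rewrite det_mulmx det_lblock det_ublock !det1 mulr1 mul1r det_mx11 !mxE.
by rewrite eqxx mulr1n.
Qed.

(* Append to a minor of [psum a] one more row and a column C far to the right,
   and subtract from each row the next one: this gives a minor of [a] bordered
   by a column that is negligible except for its last entry. *)
Lemma top_minors_psum a :
  negligible a (psum a) -> eventually_positive (psum a) ->
  top_minors_ge0 (psum a) -> top_minors_ge0 a.
Proof.
move=> neg [eps eps0 [N0 pos]] Hb m c hc.
set D := matrix_of_fun _ _; rewrite leNgt; apply/negP => det_lt0.
pose low : 'rV[R]_m := \row_j toeplitz_entry (psum a) m (c j).
pose g := low *m invmx D.
(* Each of the m terms of [g *m x] becomes at most y/(m+1), so the Schur complement is positive and
   the bordered minor has the negative sign of [\det D]. *)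
have [N1 HN1] : exists N, forall n, (N <= n)%N -> forall i : 'I_m,
    m.+1%:R * `|g 0 i| * `|a (n + (m - i))%N| <= psum a n.
  by apply: eventually_all => i; apply: neg; rewrite mulr_ge0.
pose N := (N0 + N1 + \sum_j c j)%N.
pose C := (m + N).+1.
pose c' (j : 'I_(m + 1)) := match split j with inl j0 => c j0 | inr _ => C end.
have c'l j : c' (lshift 1 j) = c j by rewrite /c' (unsplitK (inl j)).
have c'r j : c' (rshift m j) = C by rewrite /c' (unsplitK (inr j)).
have hc' (i j : 'I_(m + 1)) : (i < j)%N -> (c' i < c' j)%N.
  case: (split_ordP i) => i' ->; case: (split_ordP j) => j' ->;
    rewrite ?c'l ?c'r /=; first exact: hc.
  - by move=> _; rewrite /C /N (bigD1 i') //=; lia.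
  - by have := ltn_ord j'; lia.
  - by rewrite !ord1; lia.
pose x : 'cV[R]_m := \col_i toeplitz_entry a i C.
pose W := block_mx D x low (toeplitz_entry (psum a) m C)%:M.
(* This unitriangular matrix undoes the row differences. *)
pose V : 'M[R]_(m + 1) := \matrix_(i, s) (i <= s)%:R.
have WE s j : W s j = if (s < m)%N then toeplitz_entry a s (c' j)
    else toeplitz_entry (psum a) m (c' j).
  case: (split_ordP s) => s' ->; case: (split_ordP j) => j' ->;
    rewrite ?c'l ?c'r /=.
  - by rewrite block_mxEul mxE.
  - by rewrite block_mxEur mxE.
  - by rewrite block_mxEdl mxE.
  - by rewrite block_mxEdr mxE !ord1 eqxx mulr1n.
have VW : \matrix_(i < m + 1, j < m + 1) toeplitz_entry (psum a) i (c' j) = V *m W.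
  apply/matrixP => i j; rewrite !mxE big_split_ord /= big_ord1.
  have leim : (i <= m)%N by have := ltn_ord i; lia.
  rewrite (@toeplitz_entry_psum_split a m) //; congr (_ + _).
    by apply: eq_bigr => s _; rewrite WE [V _ _]mxE /= ltn_ord.
  by rewrite WE [V _ _]mxE /= addn0 ltnn leim mul1r.
have detV : \det V = 1.
  rewrite -det_tr det_trig.
    by rewrite big1 // => i _; rewrite !mxE leqnn.
  by apply/is_trig_mxP => i j ltij; rewrite !mxE leqNgt ltij.
have := Hb _ c' hc'; rewrite VW det_mulmx detV mul1r det_bordered ?lt_eqF //.
rewrite nmulr_rge0 // -/g subr_le0 leNgt => /negP; apply.
have yE : toeplitz_entry (psum a) m C = psum a N.+1.
  by rewrite /C -addnS toeplitz_entry_add.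
have xE i : x i 0 = a (N.+1 + (m - i))%N.
  rewrite mxE -[in RHS](toeplitz_entry_add a i); congr toeplitz_entry.
  by rewrite /C; have := ltn_ord i; lia.
have y0 : 0 < psum a N.+1.
  by apply: lt_le_trans eps0 (pos _ _); rewrite /N; lia.
rewrite yE mxE -(ltr_pM2l (ltr0Sn R m)) mulr_sumr.
apply: (@le_lt_trans _ _ (\sum_(i < m) psum a N.+1)).
  apply: ler_sum => i _; apply: le_trans (HN1 N.+1 _ i); last by rewrite /N; lia.
  by rewrite xE -mulrA ler_pM2l // -normrM ler_norm.
by rewrite sumr_const card_ord -[X in X < _]mulr_natl ltr_pM2r // ltr_nat.
Qed.

(** * Growth of coefficients and removal of factors 1/(1-t) *)

Section Growth.
Variables (p : {poly R}) (p1_gt0 : 0 < p.[1]).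

Lemma gcoef1_eventually n : (size p <= n)%N -> gcoef p 1 n = p.[1].
Proof.
move=> sp; rewrite (@horner_coef_wide _ n.+1) ?leqW //.
by apply: eq_bigr => i _; rewrite expr1n mulr1.
Qed.

(** The coefficients grow like p(1) n^(m-1)/(m-1)! for m >= 1; only comparisons of successive orders
    are proved, starting from an eventually zero and an eventually constant sequence. *)
Lemma gcoef_growth m :
  negligible (gcoef p m) (gcoef p m.+1) /\ eventually_positive (gcoef p m.+1).
Proof.
have pos1 : eventually_positive (gcoef p 1).
  by exists p.[1] => //; exists (size p) => n /gcoef1_eventually->.
have next_pos i : negligible (gcoef p i) (gcoef p i.+1) ->
    eventually_positive (gcoef p i) -> eventually_positive (gcoef p i.+1).
  move=> neg [c c0 [N HN]]; exists c => //.
  have [N' HN'] := neg 1 0%N ler01; exists (maxn N N') => n.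
  rewrite geq_max => /andP[n1 n2]; apply: le_trans (HN _ n1) _.
  by apply: le_trans (HN' _ n2); rewrite addn0 mul1r ler_norm.
have neg0 : negligible (gcoef p 0) (gcoef p 1).
  move=> K l K0; exists (size p) => n sn.
  rewrite gcoef1_eventually // /gcoef /= nth_default ?normr0 ?mulr0 ?ltW //.
  by rewrite (leq_trans sn) // leq_addr.
have unbounded i : eventually_positive (gcoef p i) ->
    forall x : R, exists N, forall n, (N <= n)%N -> x <= gcoef p i.+1 n.
  move=> [c c0 [N HN]] x.
  have sum_ge n : gcoef p i.+1 N + n%:R * c <= gcoef p i.+1 (N + n).
    elim: n => [|n IHn]; first by rewrite mul0r addr0 addn0.
    rewrite addnS gcoefS -natr1 mulrDl mul1r addrA lerD //.
    by apply: HN; lia.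
  pose k := Num.truncn (`|x - gcoef p i.+1 N| / c).
  exists (N + k.+1)%N => n len.
  rewrite -(@subnKC N n); last by lia.
  apply: le_trans (sum_ge _); rewrite -lerBlDl -ler_pdivrMr //.
  apply: (@le_trans _ _ k.+1%:R); last by rewrite ler_nat; lia.
  rewrite ltW // (le_lt_trans _ (truncnS_gt _)) //.
  by rewrite ler_pM2r ?invr_gt0 // ler_norm.
have neg1 : negligible (gcoef p 1) (gcoef p 2).
  move=> K l K0.
  have [N HN] := unbounded 1%N pos1 (K * p.[1]).
  exists (size p + N)%N => n len.
  rewrite gcoef1_eventually; last by lia.
  by rewrite gtr0_norm // HN //; lia.
(* Summing the bound with constant 2(K+1) gives the next bound up to an additive constant; half of
   the factor absorbs it, as the sequence is unbounded. *)
have step i : negligible (gcoef p i.+1) (gcoef p i.+2) ->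
    eventually_positive (gcoef p i.+1) -> negligible (gcoef p i.+2) (gcoef p i.+3).
  move=> neg pos K l K0; have [c c0 [N1 HN1]] := next_pos _ neg pos.
  have K1 : 0 < K + 1 by lra.
  have K2 : 0 <= 2 * (K + 1) by lra.
  have [N HN] := neg _ l K2.
  have sum_ge n : gcoef p i.+3 N +
      2 * (K + 1) * (gcoef p i.+2 (N + n + l) - gcoef p i.+2 (N + l)) <=
      gcoef p i.+3 (N + n).
    elim: n => [|n IHn]; first by rewrite addn0 subrr mulr0 addr0.
    rewrite addnS addSn gcoefS [gcoef p i.+3 _.+1]gcoefS.
    have := HN (N + n).+1 _; rewrite addSn => /(_ ltac:(lia)).
    have := ler_wpM2l K2 (ler_norm (gcoef p i.+1 (N + n + l).+1)).
    move: IHn; lra.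
  pose x := (2 * (K + 1) * gcoef p i.+2 (N + l) - gcoef p i.+3 N) / (K + 1).
  have [N2 HN2] := unbounded _ pos x.
  exists (N + N1 + N2)%N => n len.
  have pos_n : 0 < gcoef p i.+2 (n + l) by apply: lt_le_trans c0 (HN1 _ _); lia.
  rewrite gtr0_norm //; have := sum_ge (n - N)%N.
  rewrite subnKC; last by lia.
  have : x <= gcoef p i.+2 (n + l) by apply: HN2; lia.
  rewrite /x ler_pdivrMr //; nra.
case: m => [//|m].
suff [neg pos] : negligible (gcoef p m.+1) (gcoef p m.+2) /\
    eventually_positive (gcoef p m.+1) by split=> //; apply: next_pos.
elim: m => // m [neg pos]; split; [exact: step | exact: next_pos].
Qed.

Lemma gcoef_top_minors m : top_minors_ge0 (gcoef p m) -> forall n, 0 <= p`_n.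
Proof.
elim: m => [|m IHm] H n; first exact: top_minors_coef n H.
by have [neg pos] := gcoef_growth m; apply: IHm; apply: top_minors_psum.
Qed.

End Growth.

(** For p = t^j with 1 <= j <= n+1 and m >= 1, the two sides are n-j+1 and n times the same binomial
    coefficient, with equality at j = 1. The induction uses only the Pascal rule [gcoefS]. *)
Lemma gcoef_ratio p m n : p`_0 = 0 -> (forall n, 0 <= p`_n) ->
  m%:R * gcoef p m.+1 n <= n%:R * gcoef p m n.+1.
Proof.
move=> p0 p_ge0; elim: m n => [|m IHm] n; first by rewrite mul0r mulr_ge0 //; apply: p_ge0.
elim: n => [|n IHn]; first by rewrite gcoef0 p0 mulr0 mul0r.
have := IHm n.+1; move: IHn.
rewrite [gcoef p m.+2 n.+1]gcoefS [gcoef p m.+1 n.+2]gcoefS -!natr1; lra.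
Qed.

(* [H k n] stands for the complete homogeneous symmetric polynomial of degree k
   in the variables X 1, ..., X n. *)
Lemma hsym_min (H : nat -> nat -> R) (X : nat -> R) (y : R) (P : nat) :
  (forall n, H 0%N n = 1) -> (forall k, H k.+1 0%N = 0) ->
  (forall k n, H k.+1 n.+1 = H k.+1 n + X n.+1 * H k n.+1) ->
  0 <= y -> (forall i, (0 < i <= P)%N -> y <= X i) ->
  forall k n, (n <= P)%N ->
    0 <= H k n /\ (k + n)%:R * (y * H k n) <= k.+1%:R * H k.+1 n.
Proof.
move=> H0 HS0 HSS y0 Xy.
have H_ge0 k n : (n <= P)%N -> 0 <= H k n.
  elim: k n => [|k IHk] n; first by rewrite H0.
  elim: n => [|n IHn] len; first by rewrite HS0.
  rewrite HSS addr_ge0 ?(IHn (ltnW len)) ?mulr_ge0 ?IHk //.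
  by apply: le_trans y0 (Xy _ _); rewrite len.
move=> k n len; split; first exact: H_ge0.
elim: k n len => [|k IHk]; elim=> [|n IHn] len.
- by rewrite mul0r HS0 mulr0.
- have := IHn (ltnW len); have := Xy n.+1; rewrite len => /(_ isT).
  by rewrite HSS !H0 !add0n -natr1; lra.
- by rewrite !HS0 !mulr0.
have hX : y <= X n.+1 by apply: Xy; rewrite len.
have h1 := IHn (ltnW len); have h2 := IHk _ len.
have h3 := H_ge0 k.+1 _ len.
have h4 := ler_wpM2l (le_trans y0 hX) h2.
have h5 := ler_wpM2r h3 hX.
rewrite [H k.+2 _]HSS.
(* Of the k+n+2 copies of this product, k+n+1 are split by the recurrence and bounded by the two
   induction hypotheses; the last uses y <= X_(n+1). *)
have e : y * H k.+1 n.+1 = y * H k.+1 n + X n.+1 * (y * H k n.+1).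
  by rewrite HSS; ring.
move: h1 h4; rewrite !addnS !addSn -!natr1 natrD => h1 h4.
suff : (k%:R + n%:R + 1) * (y * H k.+1 n.+1) <=
   (k%:R + 1 + 1) * H k.+2 n + (k%:R + 1) * (X n.+1 * H k.+1 n.+1).
  lra.
rewrite {1}e; lra.
Qed.

Lemma JS_rec (w : R) k n : JS w (k.+1 + n.+1) n.+1 =
  JS w (k.+1 + n) n + n.+1%:R * (n.+1%:R + w) * JS w (k + n.+1) n.+1.
Proof. by rewrite addSn addnS /=. Qed.

Lemma JS_1 (w : R) k : JS w (k + 1) 1 = (1 + w) ^+ k.
Proof.
elim: k => [|k IHk]; first by rewrite JSnn.
by rewrite JS_rec IHk addn0 /= add0r mul1r exprS.
Qed.

Lemma js_1 (w : R) k : js w (k + 1) 1 = \prod_(i < k) (i.+1%:R * (i.+1%:R + w)).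
Proof.
elim: k => [|k IHk]; first by rewrite jsnn big_ord0.
rewrite big_ord_recr /= -IHk !addn1 /=; case: k {IHk} => [|k] /=; ring.
Qed.

Lemma num_ge0_contra (w : R) k : (0 < k)%N -> w < -1 ->
  (forall n, 0 <= (JSnum w k)`_n) -> (forall n, 0 <= (jsnum w k)`_n) -> False.
Proof.
case: k => // k _ w1 JS0 js0.
have gcoef_ge0 (p : {poly R}) m n : (forall n, 0 <= p`_n) -> 0 <= gcoef p m n.
  move=> p0; elim: m n => [|m IHm] n; first exact: p0.
  by rewrite /gcoef iterS; apply: sumr_ge0 => i _; apply: IHm.
(* If -2 < w < -1, the factor 1 + w is the only negative one in [js_1]. *)
have [w2|w2] := ltP (-2) w.
  have := gcoef_ge0 _ (3 * k.+1 + 1)%N 1%N js0; rewrite -js_gcoef js_1.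
  rewrite big_ord_recl /= leNgt => /negP; apply.
  rewrite pmulr_llt0; first by lra.
  apply: prodr_gt0 => i _; rewrite mulr_gt0 // /bump /= -natr1.
  by have := ler0n R i; rewrite add1n -natr1; lra.
have evk : odd k.
  have := gcoef_ge0 _ (3 * k.+1 + 1)%N 1%N JS0; rewrite -JS_gcoef JS_1.
  apply: contraTT => evk; rewrite -ltNge exprn_odd_lt0 ?oddS //; lra.
pose p := Num.truncn (- w).
have /andP[pw wp] : p%:R <= - w < p.+1%:R by apply: truncn_itv; lra.
have p2 : (2 <= p)%N by rewrite -ltnS -(ltr_nat R); apply: le_lt_trans wp; lra.
pose X (n : nat) : R := - (n%:R * (n%:R + w)).
pose H k n := (-1) ^+ k * JS w (k + n) n.
have HP := @hsym_min H X (X p) p.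
have H0 n : H 0%N n = 1 by rewrite /H mul1r JSnn.
have HS0 i : H i.+1 0%N = 0 by rewrite /H addn0 /= mulr0.
have HSS i n : H i.+1 n.+1 = H i.+1 n + X n.+1 * H i n.+1.
  by rewrite /H JS_rec /X exprS; ring.
have Xp0 : 0 <= X p by rewrite /X -mulrN mulr_ge0 //; lra.
(* X_i - X_p = (p-i)(p+i+w), and p + i + w >= p + 1 + w > 0. *)
have Xpmin i : (0 < i <= p)%N -> X p <= X i.
  move=> /andP[i0 ip]; rewrite /X.
  have : 1 <= i%:R :> R by rewrite ler1n.
  have : i%:R <= p%:R :> R by rewrite ler_nat.
  move: wp; rewrite -natr1; nra.
have {}HP := HP H0 HS0 HSS Xp0 Xpmin.
have [_ le1] := HP k p (leqnn _).
have JSH n : JS w (k.+1 + n) n = H k.+1 n.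
  by rewrite /H -signr_odd /= evk expr0 mul1r.
have JS00 : (JSnum w k.+1)`_0 = 0.
  by have := JS_gcoef w k.+1 0; rewrite gcoef0 => <-; rewrite addn0.
have le2 := gcoef_ratio (3 * k.+1)%N p.-1 JS00 JS0.
(* The value at n = 1 is an even power of 1 + w, and all increments up to p are nonnegative. *)
have h0 : 0 < H k.+1 p.
  have H_gt0 n : (n < p)%N -> 0 < H k.+1 n.+1.
    elim: n => [|n IHn] ltnp.
      rewrite -JSH JS_1 exprn_even_gt0 ?oddS ?evk //.
      by rewrite /= lt_eqF //; lra.
    rewrite HSS ltr_wpDr ?IHn ?(ltnW ltnp) // mulr_ge0 //.
      by apply: le_trans Xp0 (Xpmin _ _).
    by case: (HP k n.+2 ltnp).
  by rewrite -(@prednK p) ?H_gt0; lia.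
have eS := HSS k p.-1; rewrite prednK in eS le2; [|lia..].
have e1 : gcoef (JSnum w k.+1) (3 * k.+1).+1 p.-1 = H k.+1 p.-1.
  by rewrite -JSH JS_gcoef addn1.
have e2 : gcoef (JSnum w k.+1) (3 * k.+1) p = X p * H k p.
  have := gcoefS (JSnum w k.+1) (3 * k.+1) p.-1.
  rewrite e1 prednK; last by lia.
  by rewrite -(addn1 (3 * k.+1)) -JS_gcoef JSH eS => /addrI.
rewrite e1 e2 in le2.
have [Hk0 _] := HP k p (leqnn _).
set t := X p * H k p in le1 le2 eS; set h := H k.+1 p in le1 eS h0.
have t0 : 0 <= t by rewrite mulr_ge0.
have p1E : p.-1%:R = p%:R - 1 :> R.
  by rewrite -[in RHS](@prednK p) -?natr1 ?addrK //; lia.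
have p2R : 2 <= p%:R :> R by rewrite ler_nat.
have pt := ler_wpM2r t0 p2R.
have hh : H k.+1 p.-1 = h - t by rewrite eS addrK.
(* The bounds are (k+p)t <= (k+1)h and 3(k+1)(h-t) <= (p-1)t. Eliminating h gives 2(p-1)t <= 0, so t
   = 0, and the second bound contradicts h > 0. *)
move: le1 le2; rewrite hh p1E !(natrM, natrD) -natr1 => le1 le2.
have t_le0 : t <= 0 by lra.
have kh : 0 <= k%:R * h by rewrite mulr_ge0 // ltW.
have tE : t = 0 by lra.
by move: le2; rewrite tE; lra.
Qed.

Lemma PF_bounds (z : R) k : (0 < k)%N ->
  PF_sequence (fun n => JS z (k + n) n) ->
  PF_sequence (fun n => js z (k + n) n) -> -1 <= z <= 1.
Proof.
move=> k0 PFJS PFjs.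
have JS0 n : 0 <= (JSnum z k)`_n.
  apply: (@gcoef_top_minors _ (JSnum_eval1 z k) (3 * k + 1)).
  by apply: PF_top_minors; apply: eq_PF PFJS => i; rewrite JS_gcoef.
have js0 n : 0 <= (jsnum z k)`_n.
  apply: (@gcoef_top_minors _ (jsnum_eval1 z k) (3 * k + 1)).
  by apply: PF_top_minors; apply: eq_PF PFjs => i; rewrite js_gcoef.
apply/andP; split; rewrite leNgt; apply/negP => zlt.
  exact: num_ge0_contra k0 zlt JS0 js0.
(* Reversal exchanges the two numerators while z becomes -z; coefficients beyond 2k+1 vanish by
   degree. *)
apply: (@num_ge0_contra (- z) k k0); first by lra.
- move=> n; have [len|ltn] := leqP n (2 * k).+1.
    have := revp_JSnum_jsnum (- z) k0; rewrite opprK => /(_ n ((2 * k).+1 - n)%N).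
    by move=> -> //; rewrite subnKC.
  by rewrite nth_default // (leq_trans (size_JSnum _ _)) // ltnW.
- move=> n; have [len|ltn] := leqP n (2 * k).+1.
    have /(_ ((2 * k).+1 - n)%N n) := revp_JSnum_jsnum z k0.
    by move=> <- //; rewrite subnK.
  by rewrite nth_default // (leq_trans (size_jsnum _ _)) // ltnW.
Qed.

End Necessity.

Unset Implicit Arguments.

Theorem theorem1p1 (R : realType) (k : nat) (hk : (1 <= k)%N) (z : R) :
  (PF_sequence (fun n : nat => JS z (k + n)%N n) /\
   PF_sequence (fun n : nat => js z (k + n)%N n))
  <-> -1 <= z <= 1.
Proof.
split=> [[PFJS PFjs]|zin]; first exact: PF_bounds hk PFJS PFjs.
by split; [apply: JS_PF | apply: js_PF].
Qed.
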